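(* Let $n,\delta$ be positive integers. Any data structure that supports ${\textsf{rankA}}_1$ queries, or ${\textsf{dselectA}}_1$ queries, with additive error $\delta$ on an arbitrary bit-string of length $n$ requires at least $\lfloor n/(2\delta)\rfloor\lg\delta$ bits.
   Context: For a bit-string $B[1\dots n]$ and $b\in\{0,1\}$: ${\textsf{rank}}_b(i,B)$ is the number of $b$'s in $B[1\dots i]$, and ${\textsf{select}}_b(i,B)$ is the position of the $i$-th $b$ in $B$. ${\textsf{rankA}}_b(i,B,\delta)$ returns any value $r$ with ${\textsf{rank}}_b(i-\delta,B)<r\le{\textsf{rank}}_b(i,B)$, and if ${\textsf{rank}}_b(i-\delta,B)={\textsf{rank}}_b(i,B)$ it returns ${\textsf{rank}}_b(i,B)$. ${\textsf{dselectA}}_b(i,B,\delta)$ returns any position $p$ with ${\textsf{select}}_b(i,B)-\delta<p\le{\textsf{select}}_b(i,B)$. *)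

(* Defs.v *)
From mathcomp Require Import all_boot all_order all_algebra.
From mathcomp Require Import reals exp.

Set Implicit Arguments.
Unset Strict Implicit.
Unset Printing Implicit Defensive.

(* Positions in a bit-string are 1-based: B[j] is [nth _ B j.-1]. *)

Definition rank (b : bool) (i : nat) (B : seq bool) : nat :=
  count_mem b (take i B).

Definition positions (b : bool) (B : seq bool) : seq nat :=
  [seq j <- iota 1 (size B) | nth (~~ b) B j.-1 == b].

(* Meaningful for 1 <= i <= count_mem b B; it is 0 for larger i. *)
Definition select (b : bool) (i : nat) (B : seq bool) : nat :=
  nth 0 (positions b B) i.-1.

(* When i < delta the truncated i - delta is 0, and rank b 0 B = 0, which is
   the number of b's in the empty prefix. *)
Definition rankA_answer (b : bool) (i : nat) (B : seq bool) (delta r : nat) :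
    bool :=
  if rank b (i - delta) B == rank b i B then r == rank b i B
  else rank b (i - delta) B < r <= rank b i B.

(* select b i B < p + delta is select b i B - delta < p over the integers;
   0 < p because the answer is a position of B. *)
Definition dselectA_answer (b : bool) (i : nat) (B : seq bool) (delta p : nat) :
    bool :=
  [&& 0 < p, select b i B < p + delta & p <= select b i B].

(* A data structure occupying s bits for bit-strings of length n: queries only
   see the s stored bits. Both maps may depend on n (and on delta), and no
   computability or time bound is imposed on them. *)
Record data_structure (n s : nat) := DataStructure {
  encode : n.-tuple bool -> s.-tuple bool;
  query : s.-tuple bool -> nat -> nat
}.

Definition supports_rankA (b : bool) (delta n s : nat)
    (D : data_structure n s) : Prop :=
  forall (B : n.-tuple bool) (i : nat), 0 < i <= n ->
    rankA_answer b i B delta (query D (encode D B) i).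

Definition supports_dselectA (b : bool) (delta n s : nat)
    (D : data_structure n s) : Prop :=
  forall (B : n.-tuple bool) (i : nat), 0 < i <= count_mem b B ->
    dselectA_answer b i B delta (query D (encode D B) i).

Definition lg (R : realType) (x : R) : R := (ln x / ln 2)%R.

(* Main.v *)
(** Cut the string into blocks of length 2 delta and let the k-th block be
    1^v 0^delta 1^(delta - v), where v < delta is free.  Two such strings whose
    first different blocks are v < v' read A 0^delta X and A 1 Y, where A ends
    with 1^v and X contains a 1.  No answer to the rank query at |A| + delta is
    valid for both strings, and no answer to the select query for the
    (|A|_1 + 1)-th one is, because its two positions are at least delta apart.
    The delta^m strings obtained from m = n / (2 delta) blocks therefore have
    pairwise distinct encodings. *)

Require Import Defs.
From mathcomp Require Import all_boot all_order all_algebra.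
From mathcomp Require Import reals exp.
From mathcomp Require Import zify.

Import Order.TTheory GRing.Theory Num.Theory.

Lemma rank_size_cat b A Z : rank b (size A) (A ++ Z) = count_mem b A.
Proof. by rewrite /rank take_size_cat. Qed.

Lemma rank_size_addn_cat b A Z k :
  rank b (size A + k) (A ++ Z) = count_mem b A + rank b k Z.
Proof. by rewrite /rank takeD take_size_cat // drop_size_cat // count_cat. Qed.

Lemma positions_cat b A Z :
  positions b (A ++ Z) = positions b A ++ map (addn (size A)) (positions b Z).
Proof.
rewrite /positions size_cat iotaD filter_cat; congr (_ ++ _).
  apply: eq_in_filter => j; rewrite mem_iota => Hj.
  by rewrite nth_cat; case: ltnP => //; lia.
rewrite addnC iotaDl filter_map; congr map.
apply: eq_in_filter => j; rewrite mem_iota => Hj /=.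
rewrite nth_cat; case: ltnP; first by lia.
by move=> _; congr (nth _ _ _ == _); lia.
Qed.

Lemma size_positions b B : size (positions b B) = count_mem b B.
Proof.
elim: B => //= x B IH; rewrite -cat1s positions_cat size_cat size_map IH.
by case: b x {IH} => [] [].
Qed.

(** The upper bound on [i] keeps the lookup inside [positions b Z]; past its end, the default 0
    would not be shifted by [size A]. *)
Lemma select_cat {b} A {Z i} : 0 < i <= count_mem b Z ->
  select b (count_mem b A + i) (A ++ Z) = size A + select b i Z.
Proof.
move=> /andP[i0 iZ]; rewrite /select positions_cat nth_cat size_positions.
case: ltnP; first by lia.
move=> _; rewrite (nth_map 0) ?size_positions; last by lia.
by congr (_ + nth _ _ _); lia.
Qed.

Lemma select_gt0 {b B i} : 0 < i <= count_mem b B -> 0 < select b i B.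
Proof.
move=> Hi; have : select b i B \in positions b B.
  by apply: mem_nth; rewrite size_positions; lia.
by rewrite mem_filter mem_iota => /andP[_ /andP[]].
Qed.

(** Oriented: [B] carries the zeros. The one in [X] makes the distinguishing select query legal on
    [B]. *)
Definition diverge (delta : nat) (B B' : seq bool) : Prop :=
  exists A X Y : seq bool, [/\ B = A ++ nseq delta false ++ X,
    B' = A ++ true :: Y & true \in X].

Lemma diverge_cat delta P B B' :
  diverge delta B B' -> diverge delta (P ++ B) (P ++ B').
Proof.
move=> [A [X [Y [-> -> HX]]]].
by exists (P ++ A), X, Y; rewrite !catA.
Qed.

Lemma count_mem_true_false k : count_mem true (nseq k false) = 0.
Proof. by rewrite count_nseq. Qed.

(** The last [delta] bits before the query point are all zero in [B], which forces the answer |A|_1;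
    in [B'] they start with a one, so the answer must exceed |A|_1. *)
Lemma diverge_rankA {delta B B'} : 0 < delta -> diverge delta B B' ->
  exists2 i, 0 < i <= size B & forall r,
    rankA_answer true i B delta r -> rankA_answer true i B' delta r -> False.
Proof.
move=> d0 [A [X [Y [-> -> _]]]]; exists (size A + delta).
  by rewrite !size_cat size_nseq; lia.
move=> r; rewrite /rankA_answer addnK !rank_size_cat !rank_size_addn_cat.
have -> : rank true delta (nseq delta false ++ X) = 0.
  by rewrite /rank take_size_cat ?size_nseq // count_mem_true_false.
have : 0 < rank true delta (true :: Y) by case: delta d0.
rewrite addn0 eqxx => H /eqP ->; case: eqP; first by lia.
by rewrite ltnn.
Qed.

(** The queried one is at |A| + 1 in [B'], so p <= |A| + 1; in [B] it lies beyond |A| + [delta], so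
    p > |A| + 1. *)
Lemma diverge_dselectA {delta B B'} : diverge delta B B' ->
  exists2 i, (0 < i <= count_mem true B) && (i <= count_mem true B') &
    forall p, dselectA_answer true i B delta p ->
      dselectA_answer true i B' delta p -> False.
Proof.
move=> [A [X [Y [-> -> HX]]]]; exists (count_mem true A + 1).
  move: HX; rewrite -has_pred1 has_count !count_cat /= count_mem_true_false.
  by lia.
have X0 : 0 < 1 <= count_mem true X by rewrite /= -has_count has_pred1.
move=> p; rewrite /dselectA_answer !select_cat //; last first.
  by rewrite count_cat count_mem_true_false.
have -> : select true 1 (nseq delta false ++ X) = delta + select true 1 X.
  by have := select_cat (nseq delta false) X0;
     rewrite count_mem_true_false size_nseq.
have -> : select true 1 (true :: Y) = 1 by [].
by have := select_gt0 X0; lia.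
Qed.

Definition block (delta v : nat) : seq bool :=
  nseq v true ++ nseq delta false ++ nseq (delta - v) true.

Lemma size_block delta v : v <= delta -> size (block delta v) = 2 * delta.
Proof. by rewrite /block !size_cat !size_nseq; lia. Qed.

Lemma diverge_block delta v v' Q Q' : v < v' -> v < delta ->
  diverge delta (block delta v ++ Q) (block delta v' ++ Q').
Proof.
move=> vv' vd.
(* The last witness is what remains of the second string after its first v + 1 ones. *)
exists (nseq v true), (nseq (delta - v) true ++ Q),
  (nseq (v' - v.+1) true ++ nseq delta false ++ nseq (delta - v') true ++ Q').
split; first by rewrite /block -!catA.
- rewrite -cat_cons -[true :: _]/(nseq (v' - v.+1).+1 true) catA -nseqD.
  by rewrite /block -!catA addnS -addSn subnKC.
- by rewrite mem_cat mem_nseq eqxx subn_gt0 vd.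
Qed.

Definition blocks {delta : nat} (f : seq 'I_delta) : seq bool :=
  flatten [seq block delta (nat_of_ord v) | v <- f].

Lemma size_blocks delta (f : seq 'I_delta) :
  size (blocks f) = size f * (2 * delta).
Proof.
elim: f => //= v f IH.
by rewrite /blocks /= size_cat IH size_block ?mulSn // ltnW.
Qed.

(** Equal leading blocks are absorbed into the common prefix; the order of the first unequal pair
    decides the orientation. *)
Lemma diverge_blocks {delta} {f g : seq 'I_delta} Q :
  size f = size g -> f <> g ->
  diverge delta (blocks f ++ Q) (blocks g ++ Q) \/
  diverge delta (blocks g ++ Q) (blocks f ++ Q).
Proof.
elim: f g => [|v f IH] [|w g] //= [sfg] fg; rewrite /blocks /= -!(catA (block _ _)).
case: (ltngtP v w) => [vw|wv|/val_inj vw].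
- by left; apply: diverge_block.
- by right; apply: diverge_block.
- subst w; case: (IH g sfg); first by move=> e; apply: fg; rewrite e.
  + by left; apply: diverge_cat.
  + by right; apply: diverge_cat.
Qed.

(** Equal encodings would give both strings the same answer to the distinguishing query. *)
Lemma supports_diverge_encode {delta n s} {D : data_structure n s}
    (B B' : n.-tuple bool) :
  0 < delta -> supports_rankA true delta D \/ supports_dselectA true delta D ->
  diverge delta B B' -> encode D B <> encode D B'.
Proof.
move=> d0 [sD|sD] dv e.
- have [i iB nr] := diverge_rankA d0 dv.
  rewrite size_tuple in iB; apply: (nr _ (sD B i iB)).
  by rewrite e; apply: sD.
- have [i /andP[iB iB'] np] := diverge_dselectA dv.
  apply: (np _ (sD B i iB)); rewrite e; apply: sD.
  by case/andP: iB => ->.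
Qed.

Lemma expn_supports_le {delta n s} {D : data_structure n s} : 0 < delta ->
  supports_rankA true delta D \/ supports_dselectA true delta D ->
  delta ^ (n %/ (2 * delta)) <= 2 ^ s.
Proof.
move=> d0 sD; set m := n %/ (2 * delta).
(* A common tail pads the m blocks to length exactly [n]. *)
pose Q := nseq (n %% (2 * delta)) false.
have size_word (f : m.-tuple 'I_delta) : size (blocks f ++ Q) == n.
  by rewrite size_cat size_blocks size_tuple size_nseq -divn_eq.
pose word f : n.-tuple bool := Tuple (size_word f).
have inj : injective (fun f => encode D (word f)).
  move=> f g e; apply: val_inj; apply/eqP/negP => /negP/eqP fg.
  have [|dv|dv] := diverge_blocks Q _ fg; first by rewrite !size_tuple.
  - exact: (supports_diverge_encode (word f) (word g) d0 sD dv e).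
  - exact: (supports_diverge_encode (word g) (word f) d0 sD dv (esym e)).
by have := leq_card _ inj; rewrite !card_tuple card_ord card_bool.
Qed.

Theorem theorem3 (R : realType) (n delta s : nat) (D : data_structure n s) :
  0 < n -> 0 < delta ->
  supports_rankA true delta D \/ supports_dselectA true delta D ->
  ((n %/ (2 * delta))%:R * lg (delta%:R : R) <= s%:R)%R.
Proof.
move=> _ d0 /(expn_supports_le d0) H.
have ln2 : (0 < ln 2 :> R)%R by rewrite ln_gt0 // ltr1n.
(* Clearing the denominator ln 2 > 0 leaves the logarithm of the counting bound. *)
rewrite /lg mulrA ler_pdivrMr // !mulr_natl -!lnXn ?ltr0n //.
by rewrite ler_ln ?posrE ?exprn_gt0 ?ltr0n // -!natrX ler_nat.
Qed.
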